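(* Let $U\subset\mathbb{C}$ be a conjugate symmetric subset, and let $F:U\to\mathbb{M}$ be an arbitrary function. Then the element $F_{\mathbb{H}}(\mathbf{q})$ is a quaternion (i.e. belongs to $\mathbb{H}$) for all $\mathbf{q}\in U_{\mathbb{H}}$ if and only if $F$ is a stem function.
   Context: $\mathbb{H}$ is the real algebra of quaternions $\mathbf{x}=x_0+x_1\mathbf{j}+x_2\mathbf{k}+x_3\mathbf{l}$ (imaginary units $\mathbf{j},\mathbf{k},\mathbf{l}$), with Euclidean norm $\|\cdot\|$, real part $\Re\mathbf{x}=x_0$ and imaginary part $\Im\mathbf{x}=x_1\mathbf{j}+x_2\mathbf{k}+x_3\mathbf{l}$. $\mathbb{M}=\mathbb{C}\otimes_{\mathbb{R}}\mathbb{H}=\mathbb{H}+i\mathbb{H}$ is its complexification, a complex algebra in which the complex unit $i$ (independent of $\mathbf{j},\mathbf{k},\mathbf{l}$) commutes with $\mathbb{H}$; it contains $\mathbb{C}$ and $\mathbb{H}$. The conjugation of $\mathbb{M}$ is $\overline{\mathbf{b}+i\mathbf{c}}=\mathbf{b}-i\mathbf{c}$ for $\mathbf{b},\mathbf{c}\in\mathbb{H}$. For $\mathbf{q}\in\mathbb{H}$ put $s_\pm(\mathbf{q})=\Re\mathbf{q}\pm i\|\Im\mathbf{q}\|\in\mathbb{C}$ and $\sigma(\mathbf{q})=\{s_+(\mathbf{q}),s_-(\mathbf{q})\}$ (the spectrum of $\mathbf{q}$ in $\mathbb{M}$). A set $U\subset\mathbb{C}$ is conjugate symmetric if $\zeta\in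 U\iff\bar\zeta\in U$. Put $U_{\mathbb{H}}=\{\mathbf{q}\in\mathbb{H}:\sigma(\mathbf{q})\subset U\}$. A function $F:U\to\mathbb{M}$ on a conjugate symmetric set is a stem function if $F(\bar\lambda)=\overline{F(\lambda)}$ for all $\lambda\in U$. For $F:U\to\mathbb{M}$, the function $F_{\mathbb{H}}:U_{\mathbb{H}}\to\mathbb{M}$ is defined by $$F_{\mathbb{H}}(\mathbf{q})=F(s_+(\mathbf{q}))\,\iota_+(\mathfrak{s})+F(s_-(\mathbf{q}))\,\iota_-(\mathfrak{s}),\qquad \mathfrak{s}=\frac{\Im\mathbf{q}}{\|\Im\mathbf{q}\|},\quad \iota_\pm(\mathfrak{s})=\tfrac12(1\mp i\mathfrak{s}),$$ when $\Im\mathbf{q}\ne0$, and $F_{\mathbb{H}}(\mathbf{q})=F(\mathbf{q})$ when $\mathbf{q}\in\mathbb{R}$. *)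

(* Defs.v *)
From HB Require Import structures.
From mathcomp Require Import all_boot all_order all_algebra.
From mathcomp Require Import classical_sets reals.
From mathcomp Require Import complex.
From mathcomp Require Import ring.

Set Implicit Arguments.
Unset Strict Implicit.
Unset Printing Implicit Defensive.

Import Order.TTheory GRing.Theory Num.Theory.
Local Open Scope classical_set_scope.
Local Open Scope ring_scope.
Local Open Scope complex_scope.

(* [Quat x0 x1 x2 x3] stands for x0 + x1 j + x2 k + x3 l, where
   j ^ 2 = k ^ 2 = l ^ 2 = -1 and j k = l = - k j.  The coefficient ring is a
   parameter: [quat R] is the algebra H of real quaternions, and [quat R[i]],
   the extension of scalars of H from R to R[i], is C (x)_R H. *)
Record quat (K : Type) := Quat {
  qcoef0 : K;
  qcoef1 : K;
  qcoef2 : K;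
  qcoef3 : K
}.

Definition tuple_of_quat (K : Type) (x : quat K) : K * K * K * K :=
  (qcoef0 x, qcoef1 x, qcoef2 x, qcoef3 x).

Definition quat_of_tuple (K : Type) (t : K * K * K * K) : quat K :=
  Quat t.1.1.1 t.1.1.2 t.1.2 t.2.

Lemma tuple_of_quatK (K : Type) : cancel (@tuple_of_quat K) (@quat_of_tuple K).
Proof. by case. Qed.

HB.instance Definition _ (K : choiceType) :=
  Choice.copy (quat K) (can_type (@tuple_of_quatK K)).

Lemma quat_eq (K : Type) (x y : quat K) :
  qcoef0 x = qcoef0 y -> qcoef1 x = qcoef1 y ->
  qcoef2 x = qcoef2 y -> qcoef3 x = qcoef3 y -> x = y.
Proof. by case: x y => ? ? ? ? [? ? ? ?] /= -> -> -> ->. Qed.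

Section QuatAlgebra.
Variable K : comNzRingType.
Implicit Types (a b : K) (x y z : quat K).

Definition quat_zero : quat K := Quat 0 0 0 0.

Definition quat_opp x : quat K :=
  Quat (- qcoef0 x) (- qcoef1 x) (- qcoef2 x) (- qcoef3 x).

Definition quat_add x y : quat K :=
  Quat (qcoef0 x + qcoef0 y) (qcoef1 x + qcoef1 y)
       (qcoef2 x + qcoef2 y) (qcoef3 x + qcoef3 y).

Fact quat_addA : associative quat_add.
Proof. by move=> x y z; apply: quat_eq; apply: addrA. Qed.

Fact quat_addC : commutative quat_add.
Proof. by move=> x y; apply: quat_eq; apply: addrC. Qed.

Fact quat_add0 : left_id quat_zero quat_add.
Proof. by move=> x; apply: quat_eq; apply: add0r. Qed.

Fact quat_addN : left_inverse quat_zero quat_opp quat_add.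
Proof. by move=> x; apply: quat_eq; apply: addNr. Qed.

HB.instance Definition _ :=
  GRing.isZmodule.Build (quat K) quat_addA quat_addC quat_add0 quat_addN.

Definition quat_one : quat K := Quat 1 0 0 0.

Definition quat_mul x y : quat K :=
  let: Quat x0 x1 x2 x3 := x in
  let: Quat y0 y1 y2 y3 := y in
  Quat (x0 * y0 - x1 * y1 - x2 * y2 - x3 * y3)
       (x0 * y1 + x1 * y0 + x2 * y3 - x3 * y2)
       (x0 * y2 - x1 * y3 + x2 * y0 + x3 * y1)
       (x0 * y3 + x1 * y2 - x2 * y1 + x3 * y0).

Fact quat_mulA : associative quat_mul.
Proof. by case=> ????[????][????]; apply: quat_eq => /=; ring. Qed.

Fact quat_mul1l : left_id quat_one quat_mul.
Proof. by case=> ????; apply: quat_eq => /=; ring. Qed.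

Fact quat_mul1r : right_id quat_one quat_mul.
Proof. by case=> ????; apply: quat_eq => /=; ring. Qed.

Fact quat_mulDl : left_distributive quat_mul quat_add.
Proof. by case=> ????[????][????]; apply: quat_eq => /=; ring. Qed.

Fact quat_mulDr : right_distributive quat_mul quat_add.
Proof. by case=> ????[????][????]; apply: quat_eq => /=; ring. Qed.

Fact quat_one_neq0 : quat_one != 0.
Proof. by apply/eqP => -[/eqP]; rewrite oner_eq0. Qed.

HB.instance Definition _ := GRing.Zmodule_isNzRing.Build (quat K)
  quat_mulA quat_mul1l quat_mul1r quat_mulDl quat_mulDr quat_one_neq0.

Definition quat_scale a x : quat K :=
  Quat (a * qcoef0 x) (a * qcoef1 x) (a * qcoef2 x) (a * qcoef3 x).

Fact quat_scaleA a b x : quat_scale a (quat_scale b x) = quat_scale (a * b) x.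
Proof. by apply: quat_eq; apply: mulrA. Qed.

Fact quat_scale1 : left_id 1 quat_scale.
Proof. by move=> x; apply: quat_eq; apply: mul1r. Qed.

Fact quat_scaleDr : right_distributive quat_scale +%R.
Proof. by move=> a x y; apply: quat_eq; apply: mulrDr. Qed.

Fact quat_scaleDl x : {morph quat_scale^~ x : a b / a + b}.
Proof. by move=> a b; apply: quat_eq; apply: mulrDl. Qed.

HB.instance Definition _ := GRing.Zmodule_isLmodule.Build K (quat K)
  quat_scaleA quat_scale1 quat_scaleDr quat_scaleDl.

Fact quat_scaleAl a x y : a *: (x * y) = (a *: x) * y.
Proof. by case: x y => ????[????]; apply: quat_eq => /=; ring. Qed.

HB.instance Definition _ :=
  GRing.Lmodule_isLalgebra.Build K (quat K) quat_scaleAl.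

Fact quat_scaleAr a x y : a *: (x * y) = x * (a *: y).
Proof. by case: x y => ????[????]; apply: quat_eq => /=; ring. Qed.

HB.instance Definition _ :=
  GRing.Lalgebra_isAlgebra.Build K (quat K) quat_scaleAr.

End QuatAlgebra.

Notation quaternion R := (quat R).
Notation biquaternion R := (quat R[i]).

Section StemFunctions.
Variable R : realType.
Implicit Types (q b c : quaternion R) (x : biquaternion R) (z : R[i]).
Implicit Types (U : set R[i]) (F : R[i] -> biquaternion R).

Definition qRe q : R := qcoef0 q.

Definition qIm q : quaternion R := Quat 0 (qcoef1 q) (qcoef2 q) (qcoef3 q).

Definition qnorm q : R :=
  Num.sqrt (qcoef0 q ^+ 2 + qcoef1 q ^+ 2 + qcoef2 q ^+ 2 + qcoef3 q ^+ 2).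

(* The inclusion of H in its complexification; that of C is [z |-> z%:A]. *)
Definition H_to_M q : biquaternion R :=
  Quat (qcoef0 q)%:C (qcoef1 q)%:C (qcoef2 q)%:C (qcoef3 q)%:C.

Definition is_quaternion x : Prop := range H_to_M x.

Definition H_re x : quaternion R :=
  Quat (complex.Re (qcoef0 x)) (complex.Re (qcoef1 x))
       (complex.Re (qcoef2 x)) (complex.Re (qcoef3 x)).

Definition H_im x : quaternion R :=
  Quat (complex.Im (qcoef0 x)) (complex.Im (qcoef1 x))
       (complex.Im (qcoef2 x)) (complex.Im (qcoef3 x)).

Lemma biquaternion_decomp x : x = H_to_M (H_re x) + 'i *: H_to_M (H_im x).
Proof.
case: x => -[? ?] [? ?] [? ?] [? ?].
by apply: quat_eq; apply/eqP; rewrite /= eq_complex /=; apply/andP; split;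
   apply/eqP; ring.
Qed.

Definition conjM x : biquaternion R := H_to_M (H_re x) - 'i *: H_to_M (H_im x).

Lemma conjME b c :
  conjM (H_to_M b + 'i *: H_to_M c) = H_to_M b - 'i *: H_to_M c.
Proof.
case: b c => ? ? ? ? [? ? ? ?].
by apply: quat_eq; apply/eqP; rewrite /= eq_complex /=; apply/andP; split;
   apply/eqP; ring.
Qed.

Definition s_plus q : R[i] := (qRe q)%:C + 'i * (qnorm (qIm q))%:C.

Definition s_minus q : R[i] := (qRe q)%:C - 'i * (qnorm (qIm q))%:C.

Definition spectrum q : set R[i] := [set s_plus q; s_minus q].

Definition conj_symmetric U : Prop := forall z, U z <-> U z^*.

Definition quat_domain U : set (quaternion R) := [set q | spectrum q `<=` U].

(* A function on U is represented by a total function on R[i] whose values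
   outside U are irrelevant. *)
Definition stem_function U F : Prop := forall z, U z -> F z^* = conjM (F z).

Definition iota_plus (s : quaternion R) : biquaternion R :=
  (2%:R^-1 : R[i]) *: (1 - 'i *: H_to_M s).

Definition iota_minus (s : quaternion R) : biquaternion R :=
  (2%:R^-1 : R[i]) *: (1 + 'i *: H_to_M s).

(* For q in [quat_domain U], the extension F_H evaluates F only at points of
   [spectrum q], hence only inside U. *)
Definition quat_extension F q : biquaternion R :=
  if qIm q == 0 then F (qRe q)%:C
  else let s := (qnorm (qIm q))^-1 *: qIm q in
       F (s_plus q) * iota_plus s + F (s_minus q) * iota_minus s.

End StemFunctions.

(* Main.v *)
Require Import Defs.
From mathcomp Require Import all_boot all_order all_algebra.
From mathcomp Require Import classical_sets reals.
From mathcomp Require Import complex.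
From mathcomp Require Import ring.

(** The conjugation of M is an involutive ring automorphism whose fixed points
    are exactly the quaternions ([is_quaternionP]), and it exchanges the
    idempotents iota_+(s) and iota_-(s).

    If F is a stem function, then at a non-real q the two summands of F_H(q)
    are conjugate to each other, because s_-(q) is the complex conjugate of
    s_+(q); their sum is therefore fixed by the conjugation.  At a real q the
    stem condition says directly that F(q) is fixed.

    Conversely, let z = x + i y be in U with y > 0, and put a = F(z) and
    b = F(conj z).  For an imaginary unit u, the quaternions x + y u and x - y u
    have the same spectrum and opposite units, so the values of F_H there are
    a e_+ + b e_- and a e_- + b e_+, where e_+ and e_- are the complementary
    orthogonal idempotents iota_+(u) and iota_-(u).  That both values are fixed
    by the conjugation forces b to be the conjugate of a
    ([conj_of_opposite_units]).  A single unit u is enough; here u = j.  The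
    lower half-plane follows by applying this to conj z, and for real z the
    value F_H(z) = F(z) is itself a quaternion. *)

Set Implicit Arguments.
Unset Strict Implicit.
Unset Printing Implicit Defensive.

Import Order.TTheory GRing.Theory Num.Theory.
Local Open Scope classical_set_scope.
Local Open Scope complex_scope.
Local Open Scope ring_scope.

(** * Conjugation *)

Section Conjugation.
Variable R : realType.
Implicit Types (q s u : quaternion R) (x y a b : biquaternion R) (z : R[i]).

(** The conjugation acts on coordinates, which reduces its algebraic properties
    to those of the conjugation of the complex numbers. *)
Lemma conjM_coef x :
  conjM x = Quat (qcoef0 x)^* (qcoef1 x)^* (qcoef2 x)^* (qcoef3 x)^*.
Proof.
case: x => -[? ?] [? ?] [? ?] [? ?].
by apply: quat_eq; apply/eqP; rewrite /= eq_complex /=; apply/andP; split;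
   apply/eqP; ring.
Qed.

Lemma conjMD x y : conjM (x + y) = conjM x + conjM y.
Proof. by rewrite !conjM_coef; apply: quat_eq; rewrite /= rmorphD. Qed.

Lemma conjMB x y : conjM (x - y) = conjM x - conjM y.
Proof. by rewrite !conjM_coef; apply: quat_eq; rewrite /= rmorphB. Qed.

Lemma conjM1 : conjM (1 : biquaternion R) = 1.
Proof.
by rewrite conjM_coef; apply: quat_eq; [exact: rmorph1 | exact: rmorph0 ..].
Qed.

Lemma conjMM x y : conjM (x * y) = conjM x * conjM y.
Proof.
rewrite !conjM_coef; case: x y => ????[????].
by apply: quat_eq => /=; rewrite ?(rmorphB, rmorphD, rmorphM).
Qed.

Lemma conjMZ z x : conjM (z *: x) = z^* *: conjM x.
Proof. by rewrite !conjM_coef; apply: quat_eq; rewrite /= rmorphM. Qed.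

Lemma conjMK : involutive (@conjM R).
Proof.
by case=> ? ? ? ?; rewrite !conjM_coef; apply: quat_eq; exact: conjcK.
Qed.

Lemma conjM_H q : conjM (H_to_M q) = H_to_M q.
Proof. by rewrite conjM_coef; apply: quat_eq; exact: conjc_real. Qed.

Lemma is_quaternionP x : is_quaternion x <-> conjM x = x.
Proof.
split=> [[q _ <-]|]; first exact: conjM_H.
case: x => -[? a0] [? a1] [? a2] [? a3]; rewrite conjM_coef /= => -[].
have eqN0 (r : R) : - r = r -> r = 0.
  by move/eqP; rewrite eq_sym -addr_eq0 -mulr2n mulrn_eq0 => /eqP.
move=> /eqN0-> /eqN0-> /eqN0-> /eqN0->.
by eexists (Quat _ _ _ _).
Qed.

Lemma conjM_iota_plus s : conjM (iota_plus s) = iota_minus s.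
Proof.
rewrite /iota_plus /iota_minus conjMZ conjMB conjM1 conjMZ conjM_H.
by rewrite fmorphV rmorph_nat conjCi scaleNr opprK.
Qed.

Lemma conjM_iota_minus s : conjM (iota_minus s) = iota_plus s.
Proof. by rewrite -conjM_iota_plus conjMK. Qed.

End Conjugation.

(** * The idempotents of an imaginary unit *)

Section Idempotents.
Variable R : realType.
Implicit Types (s u : quaternion R) (a b : biquaternion R).

Lemma H_to_MN s : H_to_M (- s) = - H_to_M s.
Proof. by apply: quat_eq; exact: rmorphN. Qed.

Lemma H_to_MM s u : H_to_M (s * u) = H_to_M s * H_to_M u.
Proof.
case: s u => ????[????].
by apply: quat_eq; rewrite /= ?(rmorphB, rmorphD, rmorphM).
Qed.

Lemma iota_plusN s : iota_plus (- s) = iota_minus s.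
Proof. by rewrite /iota_plus H_to_MN scalerN opprK. Qed.

Lemma iota_minusN s : iota_minus (- s) = iota_plus s.
Proof. by rewrite -iota_plusN opprK. Qed.

Lemma iotaD s : iota_plus s + iota_minus s = 1.
Proof.
rewrite -scalerDr addrACA addNr addr0 -mulr2n -(scaler_nat 2 (1 : biquaternion R)) scalerA.
by rewrite mulVf ?scale1r // pnatr_eq0.
Qed.

(** Up to a scalar the product is (1 - w) (1 + w) = 1 - w ^ 2 with w = i u, and
    w ^ 2 = - u ^ 2 = 1. *)
Lemma iota_plus_minus u : u * u = -1 -> iota_plus u * iota_minus u = 0.
Proof.
move=> uu; rewrite /iota_plus /iota_minus -scalerAl -scalerAr.
suff -> : (1 - 'i *: H_to_M u) * (1 + 'i *: H_to_M u) = 0 by rewrite !scaler0.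
rewrite mulrDr mulr1 mulrBl mul1r -scalerAl -scalerAr scalerA -H_to_MM uu.
have -> : 'i * 'i = -1 :> R[i] by rewrite -expr2 sqrCi.
have -> : H_to_M (-1 : quaternion R) = -1.
  by rewrite H_to_MN; congr (- _); apply: quat_eq.
by rewrite scaleN1r opprK addrA subrK subrr.
Qed.

Lemma iota_minus_plus u : u * u = -1 -> iota_minus u * iota_plus u = 0.
Proof.
by move=> uu; rewrite -(iota_plusN u) -(iota_minusN u) iota_plus_minus ?mulrNN.
Qed.

(** If a quaternion is a e_+ + b e_-, with e_+ and e_- the idempotents of u,
    then conjugating it and multiplying by e_+ gives a e_+ = conjM b * e_+.
    The unit -u exchanges e_+ and e_-, so the second hypothesis gives the same
    equality with e_-, and e_+ + e_- = 1. *)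
Lemma conj_of_opposite_units a b u :
    u * u = -1 ->
    is_quaternion (a * iota_plus u + b * iota_minus u) ->
    is_quaternion (a * iota_plus (- u) + b * iota_minus (- u)) ->
  b = conjM a.
Proof.
have half v : v * v = -1 ->
    is_quaternion (a * iota_plus v + b * iota_minus v) ->
    a * iota_plus v = conjM b * iota_plus v.
  move=> vv /is_quaternionP; rewrite conjMD !conjMM conjM_iota_plus.
  rewrite conjM_iota_minus => /(congr1 ( *%R^~ (iota_plus v))).
  rewrite [LHS]mulrDl [RHS]mulrDl -!mulrA iota_minus_plus // !mulr0 add0r addr0.
  have -> // : iota_plus v * iota_plus v = iota_plus v.
  by rewrite -[RHS]mulr1 -(iotaD v) mulrDr iota_plus_minus // addr0.
move=> uu /(half _ uu) ePlus /half; rewrite mulrNN iota_plusN => /(_ uu) eMinus.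
suff -> : a = conjM b by rewrite conjMK.
by rewrite -[a]mulr1 -(iotaD u) mulrDr ePlus eMinus -mulrDr iotaD mulr1.
Qed.

End Idempotents.

(** * The spectrum and the extension on slices *)

Section Extension.
Variable R : realType.
Implicit Types (q u : quaternion R) (x y : R) (F : R[i] -> biquaternion R).

Lemma s_minusE q : s_minus q = (s_plus q)^*%C.
Proof.
by apply/eqP; rewrite eq_complex /=; apply/andP; split; apply/eqP; ring.
Qed.

Lemma s_plus_real q : qIm q = 0 -> s_plus q = (qRe q)%:C.
Proof.
move=> q0; rewrite /s_plus q0 /qnorm /= expr0n /= !addr0 sqrtr0.
by rewrite [0%:C]/(0 : R[i]) mulr0 addr0.
Qed.

Lemma qnormZ x q : qnorm (x *: q) = `|x| * qnorm q.
Proof.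
by rewrite /qnorm /= !exprMn -!mulrDr sqrtrM ?sqr_ge0 // sqrtr_sqr.
Qed.

Lemma qIm_slice x y u : qcoef0 u = 0 -> qIm (x%:A + y *: u) = y *: u.
Proof. by move=> u0; apply: quat_eq; rewrite /= ?u0 ?mulr0 ?add0r. Qed.

Lemma s_plus_slice x y u : qcoef0 u = 0 -> qnorm u = 1 -> 0 < y ->
  s_plus (x%:A + y *: u) = x +i* y.
Proof.
move=> u0 u1 y0; rewrite /s_plus qIm_slice // qnormZ u1 mulr1 gtr0_norm //.
rewrite /qRe /= u0 mulr0 addr0 mulr1.
by apply/eqP; rewrite eq_complex /=; apply/andP; split; apply/eqP; ring.
Qed.

Lemma quat_extension_slice F x y u : qcoef0 u = 0 -> qnorm u = 1 -> 0 < y ->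
  quat_extension F (x%:A + y *: u) =
  F (x +i* y) * iota_plus u + F (x -i* y) * iota_minus u.
Proof.
move=> u0 u1 y0; rewrite /quat_extension s_minusE s_plus_slice // qIm_slice //.
have qn : qnorm (y *: u) = y by rewrite qnormZ u1 mulr1 gtr0_norm.
rewrite qn scalerA mulVf ?gt_eqF // scale1r ifF //.
apply/eqP => yu0; move: y0; rewrite -qn yu0 /qnorm /= expr0n /= !addr0.
by rewrite sqrtr0 ltxx.
Qed.

(** The points x + y j and x - y j have the same spectrum and opposite
    imaginary units, so F_H combines the same two values of F at both. *)
Lemma stem_upper_half_plane (U : set R[i]) F x y :
    conj_symmetric U ->
    (forall q, quat_domain U q -> is_quaternion (quat_extension F q)) ->
    0 < y -> U (x +i* y) ->
  F (x -i* y) = conjM (F (x +i* y)).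
Proof.
move=> hU FH y0 Uz; pose j : quaternion R := Quat 0 1 0 0.
have j1 : qnorm j = 1.
  by rewrite /qnorm /= !(expr0n, expr1n) /= add0r !addr0 sqrtr1.
have Nj0 : qcoef0 (- j) = 0 by rewrite /= oppr0.
have Nj1 : qnorm (- j) = 1 by rewrite -scaleN1r qnormZ normrN1 mul1r.
have FHu u : qcoef0 u = 0 -> qnorm u = 1 ->
    is_quaternion (F (x +i* y) * iota_plus u + F (x -i* y) * iota_minus u).
  move=> u0 u1; rewrite -quat_extension_slice //; apply: FH.
  move=> _ [->|->]; first by rewrite s_plus_slice.
  by rewrite s_minusE s_plus_slice //; apply: (iffLR (hU _)).
apply: (@conj_of_opposite_units _ _ _ j); [|exact: FHu|exact: FHu].
by apply: quat_eq => /=; ring.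
Qed.

End Extension.

Theorem theorem2 (R : realType) (U : set (complex R))
    (F : complex R -> biquaternion R) (hU : conj_symmetric U) :
  (forall q : quaternion R, quat_domain U q -> is_quaternion (quat_extension F q))
  <-> stem_function U F.
Proof.
split=> [FH [x y] Uz | Fstem q qU].
- have [y0|y0|y0] := ltgtP y 0.
  + (* the upper half-plane case applies to the conjugate point *)
    have /(congr1 (@conjM R)) : F (x -i* - y) = conjM (F (x +i* - y)).
      by apply: (stem_upper_half_plane hU FH); rewrite ?oppr_gt0 //; exact: (iffLR (hU _)) Uz.
    by rewrite opprK conjMK.
  + exact: (stem_upper_half_plane hU FH).
  + subst y; rewrite conjc_real.
    have Im0 : qIm (x%:A : quaternion R) = 0.
      by apply: quat_eq; rewrite /= ?mulr0.
    have Rex : qRe (x%:A : quaternion R) = x by rewrite /qRe /= mulr1.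
    have sx : s_plus (x%:A : quaternion R) = x%:C.
      by rewrite s_plus_real // Rex.
    have: is_quaternion (quat_extension F x%:A).
      by apply: FH => _ [->|->]; rewrite ?s_minusE sx ?conjc_real.
    by rewrite /quat_extension Im0 eqxx Rex => /is_quaternionP.
- have Us : U (s_plus q) by apply: qU; left.
  apply/is_quaternionP; rewrite /quat_extension; case: ifP => [/eqP q0|_].
    have sq := s_plus_real q0.
    by rewrite -sq -Fstem // sq conjc_real.
  rewrite s_minusE Fstem // conjMD !conjMM conjMK conjM_iota_plus.
  by rewrite conjM_iota_minus addrC.
Qed.
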